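(* Let $n \ge 3$ be an integer and $S_n = \{1, \ldots, n\}$. Let $p_1, \ldots, p_n$ be pairwise distinct primes, let $v_1, \ldots, v_n$ be positive integers, and let $\mathcal D$ be a subcollection of $\mathcal P_\star(S_n)$ such that $\mathcal D_0 \subseteq \mathcal D$, where $$\mathcal D_0 := \mathcal P_1(S_n) \cup \mathcal P_{n-2}(S_n) \cup \mathcal P_{n-1}(S_n).$$ Then, for every function $\varepsilon: \mathcal P_\star(S_n) \to \{\pm 1\}$ whose restriction to $\mathcal D_0$ is constant, there exists at least one prime $q \notin \{p_1, \ldots, p_n\}$ such that $q$ divides $\prod_{i \in I} p_i^{v_i} - \varepsilon(I)$ for some $I \in \mathcal D$.
   Context: For a set $X$, $\mathcal P_\star(X)$ denotes the family of all finite nonempty proper subsets of $X$ (so $\emptyset, X \notin \mathcal P_\star(X)$), and for an integer $k \ge 1$, $\mathcal P_k(X)$ denotes the family of all subsets of $X$ with exactly $k$ elements. *)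

(* Defs.v *)
From mathcomp Require Import all_boot all_order all_algebra.
Set Implicit Arguments.
Unset Strict Implicit.
Unset Printing Implicit Defensive.

(* On a finite type every subset is finite. *)
Definition Pstar (T : finType) : {set {set T}} :=
  [set A : {set T} | (A != set0) && (A != [set: T])].

Definition Pcard (T : finType) (k : nat) : {set {set T}} :=
  [set A : {set T} | #|A| == k].

Definition D0 (n : nat) : {set {set 'I_n}} :=
  Pcard 'I_n 1 :|: Pcard 'I_n (n - 2) :|: Pcard 'I_n (n - 1).

(* Main.v *)
Require Import Defs.
From mathcomp Require Import all_boot all_order all_algebra zify.
Set Implicit Arguments.
Unset Strict Implicit.
Unset Printing Implicit Defensive.
Import Order.TTheory GRing.Theory Num.Theory.

(** Write [u_i = p_i ^ v_i] and [P = \prod_i u_i], let [eps] be the common sign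
    on [D0], and suppose that no new prime appears. By coprimality
    [P / u_i - eps] is a power of [p_i], and [P / (u_i u_j) - eps = p_i^a p_j^b].
    Comparing the two relations modulo [p_i^a] shows that [p_i^a] divides
    [u_j - 1], and likewise [p_j^b] divides [u_i - 1], so
    [P / (u_i u_j) < u_i u_j] for all [i <> j]. For [n >= 4] two disjoint pairs
    contradict each other. For [n = 3], parity puts 2 among the primes, a
    computation modulo 3 and 4 puts 3 among them, and the bounds
    [p_i^a < u_j], [p_j^b < u_i] reduce what remains to a few small cases. *)

(* [m = k + 1] when [e] holds and [m = k - 1] otherwise, without subtraction. *)
Definition shifted (e : bool) (m k : nat) : Prop := m + ~~ e = k + e.

(** * Integers with few prime factors, and size bounds *)

Lemma only_prime_factor p N :
    0 < N -> (forall q, prime q -> q %| N -> q = p) ->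
  exists a, N = p ^ a.
Proof.
move=> N0 H; have : p.-nat N.
  by apply/pnatP => // q pq qN; rewrite !inE (H q).
by move/p_natP => [a ->]; exists a.
Qed.

(** The [p]-part of [N] is a power of [p], and its [p^']-part can only involve [r]. *)
Lemma only_two_prime_factors p r N :
    0 < N -> (forall q, prime q -> q %| N -> q = p \/ q = r) ->
  exists a b, N = p ^ a * r ^ b.
Proof.
move=> N0 H.
have [a ea] := p_natP (part_pnat p N).
have [b eb] : exists b, N`_p^' = r ^ b.
  apply: only_prime_factor => // q pq qN.
  have qp : q != p.
    by have /pnatP -/(_ (part_gt0 _ _) q pq qN) := part_pnat p^' N.
  case: (H q pq _) => //; last by move=> e; rewrite e eqxx in qp.
  exact: dvdn_trans qN (dvdn_part _ _).
by exists a, b; rewrite -ea -eb partnC.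
Qed.

(* Substituting [m] into the first equation, [p ^ minn a b] divides [w - 1],
   and [p ^ a = w * m -+ 1] is too large to do so. *)
Lemma power_lt_cofactor e p a b w m k :
    1 < p -> 1 < w -> 1 < m -> shifted e (w * m) (p ^ a) ->
    shifted e m (p ^ b * k) -> p ^ b < w.
Proof.
rewrite /shifted => p1 w1 m1 Ha Hb.
have dvd : p ^ minn a b %| w - 1.
  have [c ec] : exists c, p ^ a = p ^ minn a b * c.
    by exists (p ^ (a - minn a b)); rewrite -expnD subnKC ?geq_minl.
  have [d ed] : exists d, p ^ b = p ^ minn a b * d.
    by exists (p ^ (b - minn a b)); rewrite -expnD subnKC ?geq_minr.
  rewrite ec in Ha; rewrite ed in Hb.
  set X := p ^ _ in Ha Hb *.
  case: e Ha Hb => /= Ha Hb.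
    have E : X * c = X * (w * d * k) + (w - 1) by nia.
    by rewrite -(dvdn_addr _ (dvdn_mulr (w * d * k) (dvdnn X))) -E dvdn_mulr.
  have E : X * c + (w - 1) = X * (w * d * k) by nia.
  by rewrite -(dvdn_addr _ (dvdn_mulr c (dvdnn X))) E dvdn_mulr.
have le : p ^ minn a b <= w - 1 by apply: dvdn_leq => //; lia.
case: (leqP a b) => ab.
  by rewrite (minn_idPl ab) in le; case: e Ha Hb => /=; nia.
by rewrite (minn_idPr (ltnW ab)) in le; lia.
Qed.

(** Here [m <= A * B + 1 <= (w - 1) * (u - 1) + 1], and [u + w > 2]. *)
Lemma shifted_lt_mul e m A B u w :
    shifted e m (A * B) -> 1 < u -> 1 < w -> A < w -> B < u -> m < u * w.
Proof. by rewrite /shifted; case: e => /=; nia. Qed.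

(** * Prime powers, powers of 3, coprime factorizations *)

Lemma prime_dvd_exp_eq p q n : prime p -> prime q -> q %| p ^ n -> q = p.
Proof.
by move=> pp pq; rewrite Euclid_dvdX // => /andP[]; rewrite dvdn_prime2 // => /eqP.
Qed.

Lemma prime_power_gt1 p m : prime p -> 0 < m -> 1 < p ^ m.
Proof.
move=> pp m0; rewrite (leq_trans (prime_gt1 pp)) //.
by rewrite dvdn_leq ?dvdn_exp // expn_gt0 prime_gt0.
Qed.

Lemma expn3_mod8 b : 3 ^ b %% 8 = 1 \/ 3 ^ b %% 8 = 3.
Proof. by elim: b => [|b IH]; [left | rewrite expnS; lia]. Qed.

(** The modulus is [3 ^ 4 - 1 = 16 * 5], so 3 has order 4, and a residue modulo 16 determines the
    one modulo 5. *)
Lemma expn3_mod80 y : 3 ^ y %% 80 \in [:: 1; 3; 9; 27].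
Proof.
elim: y => // y; rewrite expnS -modnMmr !inE.
by case/or4P => /eqP ->.
Qed.

(* Modulo 16, the right side forces [4 %| y] when [16 %| 2 ^ g], and then 5
   divides [3 ^ y - 1]. *)
Lemma expn3_eq_succ_expn2 y g : 3 ^ y = 2 ^ g + 1 -> 3 ^ y = 3 \/ 3 ^ y = 9.
Proof.
move=> E; case: (leqP 4 g) => [g4|].
  have := expn3_mod80 y.
  have E2 : 2 ^ g = 16 * 2 ^ (g - 4) by rewrite -(expnD 2 4) subnKC.
  rewrite !inE => H.
  have : 5 %| 2 ^ g by lia.
  by move/(@prime_dvd_exp_eq 2 5 g isT isT).
have odd3 : odd (3 ^ y) by rewrite oddX orbT.
have := expn3_mod8 y.
case: g E => [|[|[|[|//]]]] /= E; lia.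
Qed.

(** By coprimality each prime power goes entirely to one factor, and neither factor can take both
    because the other exceeds 1. *)
Lemma coprime_factors p q y z A B : prime p -> prime q ->
    coprime A B -> 1 < A -> 1 < B -> A * B = p ^ y * q ^ z ->
  (A = p ^ y /\ B = q ^ z) \/ (A = q ^ z /\ B = p ^ y).
Proof.
have aux p' q' y' z' A' B' : prime p' -> prime q' -> coprime A' B' -> 1 < B' ->
    A' * B' = p' ^ y' * q' ^ z' -> p' %| A' -> A' = p' ^ y' /\ B' = q' ^ z'.
  move=> pp pq cop B1 E pA.
  have cpB : coprime p' B' by apply: coprime_dvdl pA cop.
  have Bq : B' %| q' ^ z'.
    rewrite -(@Gauss_dvdr B' (p' ^ y')) ?coprimeXr 1?coprime_sym //.
    by rewrite -E dvdn_mull.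
  have qB : q' %| B'.
    have := pdiv_dvd B'; have pB := pdiv_prime B1.
    by move=> d; rewrite -(prime_dvd_exp_eq pq pB (dvdn_trans d Bq)).
  have cqA : coprime A' q' by apply: coprime_dvdr qB cop.
  have Ap : A' %| p' ^ y'.
    by rewrite -(@Gauss_dvdl A' _ (q' ^ z')) ?coprimeXr // -E dvdn_mulr.
  have pA' : p' ^ y' %| A'.
    by rewrite -(@Gauss_dvdl _ _ B') ?coprimeXl // E dvdn_mulr.
  have EA : A' = p' ^ y' by apply/eqP; rewrite eqn_dvd Ap.
  split=> //; apply/eqP; rewrite -(@eqn_pmul2l (p' ^ y')) ?expn_gt0 ?prime_gt0 //.
  by rewrite -E EA.
move=> pp pq cop A1 B1 E.
have dA := pdiv_dvd A; have pA := pdiv_prime A1.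
have : pdiv A %| p ^ y * q ^ z by rewrite -E dvdn_mulr.
rewrite Euclid_dvdM // => /orP[] /(prime_dvd_exp_eq _ pA) -e.
  by left; apply: aux => //; rewrite -e.
by right; apply: (aux _ _ z y) => //; [rewrite E mulnC | rewrite -e].
Qed.

(** * Three primes: parity and residues modulo 3 and 4 *)

(** For [n = 3], what the complements of the index of [p] and of the other two indices provide, with
    the bounds of [power_lt_cofactor]. *)
Definition triple_eqs e p x q y r z : Prop :=
  [/\ prime p, 0 < x, exists a, shifted e (q ^ y * r ^ z) (p ^ a) &
      exists b c,
        [/\ shifted e (p ^ x) (q ^ b * r ^ c), q ^ b < r ^ z & r ^ c < q ^ y]].

Lemma triple_eqs_sym e p x q y r z :
  triple_eqs e p x q y r z -> triple_eqs e p x r z q y.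
Proof.
case=> pp x0 [a Ha] [b [c [H1 H2 H3]]]; split=> //.
  by exists a; rewrite mulnC.
by exists c, b; rewrite (mulnC (r ^ c)).
Qed.

Lemma prime_odd p : prime p -> p <> 2 -> odd p.
Proof. by move=> pp p2; case: (even_prime pp). Qed.

Lemma triple_odd e p x q y r z :
    triple_eqs e p x q y r z -> prime q -> prime r -> q <> 2 -> r <> 2 -> p = 2.
Proof.
case=> pp _ [a Ha] _ pq pr q2 r2; apply/esym/(@prime_dvd_exp_eq p 2 a) => //.
have : odd (q ^ y * r ^ z) by rewrite oddM !oddX !prime_odd // !orbT.
by move: Ha; rewrite /shifted; case: e => /=; lia.
Qed.

Lemma prime_dvd3F p n : prime p -> p <> 3 -> (3 %| p ^ n) = false.
Proof. by move=> pp p3; apply/negP => /(@prime_dvd_exp_eq p 3 n pp isT)/esym. Qed.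

Lemma expn_mod3_eq1 q y : q %% 3 = 2 -> q ^ y %% 3 = 1 -> ~~ odd y.
Proof.
move=> q2; rewrite -modnXm q2 -[y in 2 ^ y]odd_double_half expnD -mul2n expnM.
by rewrite -modnMmr -modnXm exp1n; case: (odd y).
Qed.

Lemma expn_mod4_eq1 q y : odd q -> ~~ odd y -> q ^ y %% 4 = 1.
Proof.
move=> oq oy; rewrite -[y]odd_double_half (negbTE oy) -mul2n expnM -modnXm.
suff -> : q ^ 2 %% 4 = 1 by rewrite exp1n.
by rewrite -modnXm; have [->|->] : q %% 4 = 1 \/ q %% 4 = 3 by lia.
Qed.

(** Of two consecutive non-multiples of 3, the smaller is 1 and the larger 2 modulo 3. *)
Lemma shifted_mod3 e u k : shifted e u k -> (3 %| u) = false ->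
  (3 %| k) = false -> u %% 3 = if e then 2 else 1.
Proof. by rewrite /shifted; case: e => /=; lia. Qed.

Lemma shifted_mod3_pred u k : shifted false u k -> u %% 3 = 1 -> k %% 3 = 2.
Proof. by rewrite /shifted /=; lia. Qed.

Lemma expn_mod3_eq2 s t : s ^ t %% 3 = 2 -> s %% 3 = 2.
Proof.
rewrite -modnXm => st; have : s %% 3 < 3 by rewrite ltn_mod.
case: (s %% 3) st => [|[|[|//]]] //; last by rewrite exp1n.
by case: t => // t; rewrite exp0n.
Qed.

Lemma modnM_eq1 d m n : 1 < d -> m %% d = 1 -> n %% d = 1 -> (m * n) %% d = 1.
Proof. by move=> d1 em en; rewrite -modnMml -modnMmr em en modn_small. Qed.

(** If 3 is absent, [shifted_mod3] applies to every relation. For [e] true, [q ^ y * r ^ z] would be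
    both 1 and 2 modulo 3; for [e] false, a residue modulo 4 concludes. *)
Lemma triple_three e x q y r z :
    triple_eqs e 2 x q y r z -> triple_eqs e q y 2 x r z ->
    triple_eqs e r z 2 x q y -> q <> 2 -> r <> 2 -> q = 3 \/ r = 3.
Proof.
case=> _ x0 [a Ha] [b2 [c2 [H2 _ _]]] [pq y0 [b Hb] [bq [cq [Hq _ _]]]].
case=> pr z0 [c Hc] [br [cr [Hr _ _]]] q2 r2.
have [|/eqP q3] := eqVneq q 3; first by left.
have [|/eqP r3] := eqVneq r 3; first by right.
exfalso.
have n2 m : (3 %| 2 ^ m) = false by apply: prime_dvd3F.
have nq m : (3 %| q ^ m) = false by apply: prime_dvd3F.
have nr m : (3 %| r ^ m) = false by apply: prime_dvd3F.
have nm A B : (3 %| A) = false -> (3 %| B) = false -> (3 %| A * B) = false.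
  by move=> hA hB; rewrite Euclid_dvdM // hA hB.
have ex := shifted_mod3 H2 (n2 x) (nm _ _ (nq b2) (nr c2)).
have ey := shifted_mod3 Hq (nq y) (nm _ _ (n2 bq) (nr cq)).
have ez := shifted_mod3 Hr (nr z) (nm _ _ (n2 br) (nq cr)).
have eyz := shifted_mod3 Ha (nm _ _ (nq y) (nr z)) (n2 a).
case: e Ha Hb Hc H2 Hq Hr ex ey ez eyz => Ha Hb Hc H2 Hq Hr ex ey ez eyz.
  by move: eyz; rewrite -modnMml -modnMmr ey ez.
(* [q ^ b = 2 ^ x * r ^ z + 1] is 2 modulo 3, hence so is [q]. As [q ^ y] is 1 modulo 3, [y] is
   even. The same holds for [r] and [z]. *)
have hq := expn_mod3_eq2 (shifted_mod3_pred Hb (modnM_eq1 (d := 3) isT ex ez)).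
have hr := expn_mod3_eq2 (shifted_mod3_pred Hc (modnM_eq1 (d := 3) isT ex ey)).
have fy := expn_mod4_eq1 (prime_odd pq q2) (expn_mod3_eq1 hq ey).
have fz := expn_mod4_eq1 (prime_odd pr r2) (expn_mod3_eq1 hr ez).
have f := modnM_eq1 (d := 4) isT fy fz.
have gt1 : 1 < q ^ y * r ^ z.
  by have := prime_power_gt1 pq y0; have := prime_power_gt1 pr z0; clear; nia.
(* [2 ^ a = N + 1] is 2 modulo 4, so [a = 1] and [N = 1]. *)
move: Ha f gt1; rewrite /shifted; clear; move: (q ^ y * r ^ z) => N.
case: a => [|[|a]] /=; [lia|lia|].
by rewrite !expnS; lia.
Qed.

(** * Three primes: 2, 3 and a larger prime *)

Lemma prime_power_small p n m : prime p -> p ^ n = m -> 1 < m -> p = pdiv m.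
Proof.
move=> pp E m1; apply/esym/(@prime_dvd_exp_eq _ _ n) => //; first exact: pdiv_prime.
by rewrite E pdiv_dvd.
Qed.

Lemma expn_lt_base p n : 1 < p -> p ^ n < p -> p ^ n = 1.
Proof. by case: n => // n p1; rewrite expnS; have := expn_gt0 p n; nia. Qed.

(** [2 ^ x] divides [3 ^ b + 1], which is 2 or 4 modulo 8. Thus [x <= 2], and the bounds leave
    finitely many values. *)
Lemma two_three_plus x y p z :
    triple_eqs true 2 x 3 y p z -> triple_eqs true 3 y 2 x p z ->
    triple_eqs true p z 2 x 3 y -> 3 < p -> False.
Proof.
rewrite /triple_eqs /shifted /= !addn0.
case=> _ x0 _ _ [_ y0 [b Hb] [c [d [H3 _ H3']]]].
case=> pp z0 [l Hl] [f [g [Hp Hp1 Hp2]]] p3.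
have x2 : x <= 2.
  case: (leqP x 2) => // x2; exfalso.
  have E : 2 ^ x = 8 * 2 ^ (x - 3) by rewrite -(expnD 2 3) subnKC.
  have : 8 %| 3 ^ b + 1 by rewrite -Hb E -mulnA dvdn_mulr.
  by have := expn3_mod8 b; lia.
have pd : p ^ d = 1.
  apply: expn_lt_base (prime_gt1 pp) _; apply: (leq_trans H3').
  by apply: (@leq_trans 4); rewrite ?(@leq_exp2l 2 x 2).
rewrite pd muln1 in H3.
have Y := expn3_eq_succ_expn2 H3.
have F : 2 ^ f \in [:: 1; 2; 4; 8].
  case: f {Hp} Hp1 => [|[|[|[|f]]]] // Hp1; exfalso; move: Hp1.
  by rewrite !expnS; have := expn_gt0 2 f; lia.
have G : 3 ^ g = 1 \/ 3 ^ g = 3.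
  have : 3 ^ g < 4 by apply: (leq_trans Hp2); rewrite (@leq_exp2l 2 x 2).
  by case: g {Hp Hp2} => [|[|g]]; [left|right|rewrite !expnS; have := expn_gt0 3 g; lia].
have pz : p %| p ^ z by rewrite dvdn_exp.
have X : 2 ^ x = 2 \/ 2 ^ x = 4 by case: x x0 x2 {H3' Hb Hl Hp2} => [|[|[|]]]; auto.
move: F; rewrite !inE => F.
(* These are the values of [2 ^ x * 3 ^ y - 1]. The first three determine [p], which then fails to
   divide [2 ^ f * 3 ^ g + 1]; 35 is not a prime power. *)
have [|[|[|]]] : p ^ l = 5 \/ p ^ l = 17 \/ p ^ l = 11 \/ p ^ l = 35.
- by case: X Y => eX [] eY; rewrite eX eY in Hl; clear -Hl; lia.
- move=> E; have ep : p = 5 := prime_power_small pp E isT; rewrite Hp ep in pz.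
  by case: X Y G => eX [] eY [] eG; rewrite eX eY in Hl; rewrite eG in pz;
    clear -E Hl F Hp1 Hp2 pz eX eY eG; lia.
- move=> E; have ep : p = 17 := prime_power_small pp E isT; rewrite Hp ep in pz.
  by case: X Y G => eX [] eY [] eG; rewrite eX eY in Hl; rewrite eG in pz;
    clear -E Hl F Hp1 Hp2 pz eX eY eG; lia.
- move=> E; have ep : p = 11 := prime_power_small pp E isT; rewrite Hp ep in pz.
  by case: X Y G => eX [] eY [] eG; rewrite eX eY in Hl; rewrite eG in pz;
    clear -E Hl F Hp1 Hp2 pz eX eY eG; lia.
move=> E; have e5 : 5 = p by apply: (@prime_dvd_exp_eq _ _ l); rewrite ?E.
have e7 : 7 = p by apply: (@prime_dvd_exp_eq _ _ l); rewrite ?E.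
by rewrite -e5 in e7.
Qed.

(** Modulo 3 the exponent in [2 ^ a = 3 ^ y * p ^ z + 1] is even, so [2 ^ a - 1] splits into two
    coprime factors differing by 2. *)
Lemma two_three_minus x y p z :
    triple_eqs false 2 x 3 y p z -> triple_eqs false 3 y 2 x p z ->
    triple_eqs false p z 2 x 3 y -> 3 < p -> False.
Proof.
rewrite /triple_eqs /shifted /=.
case=> _ x0 [a Ha] [f [g [H2 H2' H2'']]] [_ y0 [b Hb] [c [d [H3 _ _]]]].
case=> pp z0 _ _ p3; rewrite !addn0 in Ha H2 Hb H3.
have d3 : 3 %| 3 ^ y by rewrite dvdn_exp.
have dp : p %| p ^ z by rewrite dvdn_exp.
have z1 : 0 < p ^ z by rewrite expn_gt0 prime_gt0.
have pz : 3 < p ^ z by rewrite (leq_trans p3) // dvdn_leq.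
have y1 : 3 <= 3 ^ y by rewrite dvdn_leq ?expn_gt0.
have a2 : ~~ odd a.
  apply: (@expn_mod3_eq1 2) => //.
  by rewrite -Ha; have /dvdnP[k ->] := d3; rewrite mulnAC -modnDml modnMl.
set m := a./2; have am : a = m * 2 by rewrite /m; lia.
have m1 : 1 < m.
  case: m am => [|[|//]] am; rewrite am /= in Ha; [|]; nia.
have m4 : 4 <= 2 ^ m by rewrite (@leq_exp2l 2 2 m).
have E : (2 ^ m - 1) * (2 ^ m + 1) = 3 ^ y * p ^ z.
  by move: Ha; rewrite am expnM; nia.
have e2m : ~~ odd (2 ^ m) by rewrite oddX; case: m m1 {am m4 E}.
have cop : coprime (2 ^ m - 1) (2 ^ m + 1).
  have -> : 2 ^ m + 1 = (2 ^ m - 1) + 2 by lia.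
  by rewrite /coprime gcdnDl -/(coprime _ _) coprimen2; lia.
have [] := coprime_factors _ pp cop _ _ E; rewrite //; try lia.
(* Here [2 ^ m - 1 = 3 ^ y], so [m = 2] modulo 8 considerations, [p = 5] and [2 ^ x = 2]; then
   [3 ^ b] would be 11. *)
- case=> E3 Ep.
  have m2 : m = 2.
    case: (leqP m 2) => m2; first lia.
    have E8 : 2 ^ m = 8 * 2 ^ (m - 3) by rewrite -(expnD 2 3) subnKC.
    by have := expn3_mod8 y; lia.
  rewrite m2 /= in E3 Ep.
  have p5 : p = 5 := prime_power_small pp (esym Ep) isT.
  have f1 : 3 ^ f = 1 \/ 3 ^ f = 3.
    rewrite -Ep in H2'; move: H2'.
    by case: f {H2} => [|[|f]]; [left|right|rewrite !expnS; have := expn_gt0 3 f; lia].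
  have g1 : p ^ g = 1.
    by apply: expn_lt_base; rewrite ?prime_gt1 // (leq_trans H2'') // -E3 p5.
  have x1 : 2 ^ x = 2.
    have : ~~ odd (2 ^ x) by rewrite oddX; case: x x0 {H2 Hb H2' H2''}.
    by rewrite g1 in H2; case: f1 => f1; rewrite f1 in H2; lia.
  rewrite x1 -Ep in Hb.
  by have := @prime_power_small 3 b 11 isT (esym Hb) isT.
(* Here [2 ^ m + 1 = 3 ^ y] must be 9, so [p = 7], and [3 ^ y + 1 = 10] has the foreign factor 5. *)
case=> Ep E3.
have Y : 3 ^ y = 3 \/ 3 ^ y = 9 by apply: (@expn3_eq_succ_expn2 y m).
have y9 : 3 ^ y = 9 by case: Y; lia.
have p7 : p ^ z = 7 by lia.
have ep : p = 7 := prime_power_small pp p7 isT.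
have : 5 %| 2 ^ c * p ^ d by rewrite -H3 y9.
rewrite Euclid_dvdM // => /orP[]; first by move/(@prime_dvd_exp_eq 2 5 c isT isT).
by rewrite ep => /(@prime_dvd_exp_eq 7 5 d isT isT).
Qed.

Lemma two_three e x y p z :
    triple_eqs e 2 x 3 y p z -> triple_eqs e 3 y 2 x p z ->
    triple_eqs e p z 2 x 3 y -> p <> 2 -> p <> 3 -> False.
Proof.
move=> H1 H2 H3 p2 p3; have p4 : 3 < p by case: (H3) => /prime_gt1; lia.
by case: e H1 H2 H3 => *; [apply: two_three_plus|apply: two_three_minus]; eauto.
Qed.

Lemma triple_two_absurd e x q y r z :
    triple_eqs e 2 x q y r z -> triple_eqs e q y 2 x r z ->
    triple_eqs e r z 2 x q y -> q <> 2 -> r <> 2 -> q <> r -> False.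
Proof.
move=> H1 H2 H3 q2 r2 qr; have [e3|e3] := triple_three H1 H2 H3 q2 r2; subst.
  by apply: (two_three H1 H2 H3) => //; apply/nesym.
apply: (two_three (triple_eqs_sym H1) H3 _ q2 qr); exact: H2.
Qed.

Lemma triple_absurd e p x q y r z :
    triple_eqs e p x q y r z -> triple_eqs e q y p x r z ->
    triple_eqs e r z p x q y -> p <> q -> p <> r -> q <> r -> False.
Proof.
move=> H1 H2 H3 pq pr qr.
have [pp _ _ _] := H1; have [qp _ _ _] := H2; have [rp _ _ _] := H3.
have [e2|/eqP q2] := eqVneq q 2.
  subst; apply: (triple_two_absurd H2 H1 (triple_eqs_sym H3)) => //.
  exact: nesym.
have [e2|/eqP r2] := eqVneq r 2.
  by subst; apply: (triple_two_absurd H3 (triple_eqs_sym H1) (triple_eqs_sym H2)).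
have p2 := triple_odd H1 qp rp q2 r2; subst.
exact: (triple_two_absurd H1 H2 H3).
Qed.

(** * Products over index sets, and the cases of [n] *)

Definition subprod n (p v : 'I_n -> nat) (I : {set 'I_n}) : nat :=
  \prod_(i in I) p i ^ v i.

(** The negated conclusion on [D0], in natural numbers. Positivity of [N] excludes 0, which every
    prime divides. *)
Definition closed_under_shift e n (p v : 'I_n -> nat) : Prop :=
  forall I, I \in D0 n -> exists N, [/\ 0 < N, shifted e (subprod p v I) N &
    forall q, prime q -> q %| N -> exists i, q = p i].

Lemma shifted_coprime e m N d : shifted e m N -> d %| m -> d %| N -> d = 1.
Proof.
rewrite /shifted => H dm dN; apply/eqP; rewrite -dvdn1.
case: e H => /= H; first by rewrite -(dvdn_addr 1 dN) -H addn0.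
by rewrite -(dvdn_addr 1 dm) H addn0.
Qed.

Lemma subprod_prime_factor e n (p v : 'I_n -> nat) I N q :
    (forall i, prime (p i)) -> (forall i, 0 < v i) ->
    shifted e (subprod p v I) N ->
    (forall q, prime q -> q %| N -> exists i, q = p i) ->
    prime q -> q %| N -> exists2 i, i \notin I & q = p i.
Proof.
move=> pp v0 sh H pq qN; have [i qi] := H q pq qN; exists i => //.
apply/negP => iI.
suff q1 : q = 1 by rewrite q1 in pq.
apply: (shifted_coprime sh) => //.
by rewrite /subprod (bigD1 i) //= dvdn_mulr // qi dvdn_exp.
Qed.

Lemma setC1_D0 n (i : 'I_n) : ~: [set i] \in D0 n.
Proof. by rewrite !inE cardsC1 card_ord subn1 eqxx !orbT. Qed.

Lemma setC2_D0 n (i j : 'I_n) : i != j -> ~: [set i; j] \in D0 n.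
Proof.
move=> ij; rewrite !inE -[X in _ == X - 2](card_ord n) -(cardsC [set i; j]).
by rewrite cards2 ij addKn eqxx !orbT.
Qed.

Lemma subprodC1 n (p v : 'I_n -> nat) i j : i != j ->
  subprod p v (~: [set i]) = p j ^ v j * subprod p v (~: [set i; j]).
Proof.
move=> ij; rewrite /subprod (big_setD1 j) ?inE 1?eq_sym //=.
congr (_ * _); by apply: eq_bigl => k; rewrite !inE negb_or andbC.
Qed.

Lemma subprodC2_ge n (p v : 'I_n -> nat) (i j : 'I_n) (I : {set 'I_n}) :
    (forall i, prime (p i)) -> [disjoint I & [set i; j]] ->
  subprod p v I <= subprod p v (~: [set i; j]).
Proof.
move=> pp dis; rewrite /subprod [X in _ <= X](big_setID I) /=.
rewrite (setIidPr _) -?disjoints_subset //.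
by rewrite leq_pmulr // prodn_gt0 // => k; rewrite expn_gt0 prime_gt0.
Qed.

Lemma subprodC1_eq e n (p v : 'I_n -> nat) k :
    (forall i, prime (p i)) -> (forall i, 0 < v i) -> closed_under_shift e p v ->
  exists a, shifted e (subprod p v (~: [set k])) (p k ^ a).
Proof.
move=> pp v0 H; have [N [N0 sh HN]] := H _ (setC1_D0 k).
have [|a ea] := @only_prime_factor (p k) N N0; last by exists a; rewrite -ea.
move=> q pq qN; have [l] := subprod_prime_factor pp v0 sh HN pq qN.
by rewrite !inE negbK => /eqP ->.
Qed.

Lemma subprodC2_eq e n (p v : 'I_n -> nat) i j :
    3 <= n -> (forall i, prime (p i)) -> (forall i, 0 < v i) ->
    closed_under_shift e p v -> i != j ->
  exists a b, [/\ shifted e (subprod p v (~: [set i; j])) (p i ^ a * p j ^ b),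
                  p i ^ a < p j ^ v j & p j ^ b < p i ^ v i].
Proof.
move=> n3 pp v0 H ij.
have u1 k : 1 < p k ^ v k by apply: prime_power_gt1.
(* Since [n >= 3] there is a third index, whose factor alone exceeds 1; [power_lt_cofactor] requires
   this. *)
have m1 : 1 < subprod p v (~: [set i; j]).
  have : 0 < #|~: [set i; j]|.
    by have := cardsC [set i; j]; rewrite cards2 ij card_ord; lia.
  case/card_gt0P => k kij; apply: (leq_trans (u1 k)).
  rewrite -(big_set1 muln k (fun k => p k ^ v k)).
  by apply: subprodC2_ge => //; rewrite disjoints_subset sub1set.
have [a Ha] := subprodC1_eq i pp v0 H; have [b Hb] := subprodC1_eq j pp v0 H.
rewrite (subprodC1 _ _ ij) in Ha.
rewrite (@subprodC1 _ _ _ j i) 1?eq_sym // setUC in Hb.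
have [N [N0 sh HN]] := H _ (setC2_D0 ij).
have [|c [d ed]] := @only_two_prime_factors (p i) (p j) N N0.
  move=> q pq qN; have [l] := subprod_prime_factor pp v0 sh HN pq qN.
  by rewrite !inE negbK => /orP[] /eqP -> ->; auto.
rewrite ed in sh; exists c, d; split=> //.
  exact: power_lt_cofactor (prime_gt1 (pp i)) (u1 j) m1 Ha sh.
rewrite mulnC in sh.
exact: power_lt_cofactor (prime_gt1 (pp j)) (u1 i) m1 Hb sh.
Qed.

(* Two disjoint pairs of indices give [u2 * u3 < u0 * u1 < u2 * u3]. *)
Lemma closed_under_shift_ge4 e n (p v : 'I_n -> nat) :
    4 <= n -> (forall i, prime (p i)) -> (forall i, 0 < v i) ->
    closed_under_shift e p v -> False.
Proof.
move=> n4 pp v0 H; have n3 := ltnW n4.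
have u1 k : 1 < p k ^ v k by apply: prime_power_gt1.
have lt i j k l : i != j -> k != l -> [disjoint [set k; l] & [set i; j]] ->
    p k ^ v k * p l ^ v l < p i ^ v i * p j ^ v j.
  move=> ij kl dis; have [a [b [sh la lb]]] := subprodC2_eq n3 pp v0 H ij.
  apply: leq_ltn_trans (shifted_lt_mul sh (u1 i) (u1 j) la lb).
  apply: leq_trans (subprodC2_ge v pp dis).
  by rewrite /subprod big_setU1 ?inE //= big_set1.
pose o (m : 'I_4) := widen_ord n4 m.
have L1 := lt (o 0%R) (o 1%R) (o 2%R) (o 3%R).
have L2 := lt (o 2%R) (o 3%R) (o 0%R) (o 1%R).
have dis : [disjoint [set o 2%R; o 3%R] & [set o 0%R; o 1%R]].
  by apply/pred0P => m; rewrite !inE -!val_eqE /=; lia.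
have := ltn_trans (L1 isT isT dis) (L2 isT isT _).
by rewrite ltnn disjoint_sym => /(_ dis).
Qed.

Lemma closed_under_shift_3 e n (p v : 'I_n -> nat) :
    n = 3 -> (forall i, prime (p i)) -> injective p -> (forall i, 0 < v i) ->
    closed_under_shift e p v -> False.
Proof.
move=> n3; subst n => pp pI v0 H.
have K i j k : i != j -> i != k -> j != k ->
    triple_eqs e (p i) (v i) (p j) (v j) (p k) (v k).
  move=> ij ik jk.
  have CE : forall i j k : 'I_3, i != j -> i != k -> j != k -> ~: [set i; j] = [set k].
    move=> {}i {}j {}k {}ij {}ik {}jk; apply/esym/eqP; rewrite eqEcard cards1.
    rewrite sub1set !inE negb_or (eq_sym k i) (eq_sym k j) ik jk /=.
    by rewrite cardsCs setCK cards2 ij card_ord.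
  split=> //.
    have [a Ha] := subprodC1_eq i pp v0 H; exists a.
    by move: Ha; rewrite (subprodC1 _ _ ij) (CE i j k) // /subprod big_set1.
  have [a [b]] := subprodC2_eq (n := 3) isT pp v0 H jk.
  rewrite (CE j k i) //; try by rewrite eq_sym.
  by rewrite /subprod big_set1; exists a, b.
have N (i j : 'I_3) : i != j -> p i <> p j by move=> ij /pI /eqP; apply/negP.
by apply: (triple_absurd (K 0 1 2 _ _ _) (K 1 0 2 _ _ _) (K 2 0 1 _ _ _))%R => //;
  apply: N.
Qed.

(** * The statement over the integers *)

Local Open Scope ring_scope.

Theorem theorem1 (n : nat) (hn : (3 <= n)%N)
    (p : 'I_n -> nat) (p_prime : forall i, prime (p i)) (p_inj : injective p)
    (v : 'I_n -> nat) (v_pos : forall i, (0 < v i)%N)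
    (D : {set {set 'I_n}}) (D_star : D \subset Pstar 'I_n)
    (D0_D : D0 n \subset D)
    (eps : {set 'I_n} -> int)
    (eps_pm1 : forall I, I \in Pstar 'I_n -> eps I = 1 \/ eps I = -1)
    (eps_const : forall I J, I \in D0 n -> J \in D0 n -> eps I = eps J) :
  exists q : nat,
    [/\ prime q, forall i, q <> p i &
        exists2 I : {set 'I_n}, I \in D &
          (q%:Z %| \prod_(i in I) (p i)%:Z ^+ v i - eps I)%Z].
Proof.
pose I0 := ~: [set Ordinal (ltnW (ltnW hn))].
have I0D : I0 \in D0 n by apply: setC1_D0.
(* The common sign is read off at the sample member [I0]. *)
have [e epsE] : exists e : bool, forall I, I \in D0 n -> eps I = if e then 1 else -1.
  exists (eps I0 == 1) => I ID; rewrite (eps_const I I0) //; case: eqP => // ne.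
  by case: (eps_pm1 I0); rewrite // (subsetP D_star) // (subsetP D0_D).
have F0 I : (0 < subprod p v I)%N.
  by apply: prodn_gt0 => i; rewrite expn_gt0 prime_gt0.
pose N I := if e then (subprod p v I).-1 else (subprod p v I).+1.
have sh I : shifted e (subprod p v I) (N I).
  by rewrite /shifted /N; have := F0 I; case: (e) => /=; lia.
have NE I : I \in D0 n -> \prod_(i in I) (p i)%:Z ^+ v i - eps I = (N I)%:Z.
  move=> ID; rewrite (epsE I ID).
  have -> : \prod_(i in I) (p i)%:Z ^+ v i = (subprod p v I)%:Z.
    rewrite /subprod -natz natr_prod; apply: eq_bigr => i _.
    by rewrite natrX natz.
  by have := sh I; rewrite /shifted; case: (e) => /=; lia.
have [/exists_inP[I ID /hasP[q]]|/exists_inPn nex] :=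
    boolP [exists I in D0 n, has (fun q => q \notin codom p) (primes (N I))].
  rewrite mem_primes => /and3P[pq _ qN] qp; exists q; split=> //.
    by move=> i qi; rewrite qi codom_f in qp.
  by exists I; [exact: (subsetP D0_D) | rewrite NE // dvdzE].
exfalso.
have H : closed_under_shift e p v.
  (* [primes 0] is empty, so [nex] is informative only for [N I > 0]; a nonempty [I] makes its
     product at least 2. *)
  move=> I ID; have N0 : (0 < N I)%N.
    suff : (1 < subprod p v I)%N by rewrite /N; case: (e) => /=; lia.
    have : I \in Pstar 'I_n by rewrite (subsetP D_star) // (subsetP D0_D).
    rewrite inE => /andP[/set0Pn[i iI] _].
    apply: leq_trans (prime_gt1 (p_prime i)) (dvdn_leq (F0 I) _).
    by rewrite /subprod (bigD1 i) //= dvdn_mulr // dvdn_exp.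
  exists (N I); split=> // q pq qN; have := nex I ID.
  rewrite -all_predC => /allP /(_ q); rewrite mem_primes pq N0 qN /= negbK.
  by move=> /(_ isT) /codomP.
have [n3|n4] := leqP n 3; last exact: closed_under_shift_ge4 n4 p_prime v_pos H.
have n_eq3 : n = 3 by apply/eqP; rewrite eqn_leq n3 hn.
exact: closed_under_shift_3 n_eq3 p_prime p_inj v_pos H.
Qed.
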